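(* For every positive integer $n$, $2^{n-3}\leq m_n$, where $m_n$ denotes the number of modular lattices with exactly $n$ elements, counted up to isomorphism.
   Context: A lattice $L$ is modular if for all $a,b,c\in L$, $a\geq c$ implies $a\wedge(b\vee c)=(a\wedge b)\vee c$. *)

(* Defs.v *)
From HB Require Import structures.
From mathcomp Require Import all_boot all_order all_algebra.

Set Implicit Arguments.
Unset Strict Implicit.
Unset Printing Implicit Defensive.

Import Order.LTheory.
Local Open Scope order_scope.

Section Predicates.
Context {d d' : Order.disp_t}.

Definition modular (L : finLatticeType d) : bool :=
  [forall a : L, forall b : L, forall c : L,
    (a >= c) ==> (a `&` (b `|` c) == (a `&` b) `|` c)].

Lemma modularP (L : finLatticeType d) :
  reflect (forall a b c : L, a >= c -> a `&` (b `|` c) = (a `&` b) `|` c)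
          (modular L).
Proof.
apply: (iffP forallP) => [H a b c le_ca | H a].
  by move/forallP/(_ b)/forallP/(_ c): (H a); rewrite le_ca => /eqP.
by apply/forallP => b; apply/forallP => c; apply/implyP => /H ->.
Qed.

Definition isomorphic (L : finLatticeType d) (M : finLatticeType d') : bool :=
  [exists f : {ffun L -> M},
    [&& injectiveb f, [forall y, y \in codom f],
        [forall x, forall y, f (x `&` y) == f x `&` f y]
      & [forall x, forall y, f (x `|` y) == f x `|` f y]]].

Lemma isomorphicP (L : finLatticeType d) (M : finLatticeType d') :
  reflect (exists f : L -> M,
             [/\ bijective f, {morph f : x y / x `&` y}
               & {morph f : x y / x `|` y}])
          (isomorphic L M).
Proof.
apply: (iffP existsP) => -[f].
  case/and4P => /injectiveP f_inj /forallP f_surj /forallP fI /forallP fU.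
  exists f; split=> [|x y|x y].
  - exists (fun y => iinv (f_surj y)) => x; last exact: f_iinv.
    by apply: f_inj; rewrite f_iinv.
  - exact/eqP/(forallP (fI x)).
  - exact/eqP/(forallP (fU x)).
case=> -[g fK gK] fI fU; exists (finfun f).
apply/and4P; split.
- by apply/injectiveP => x y; rewrite !ffunE; apply: (can_inj fK).
- apply/forallP => y; apply/codomP; exists (g y); by rewrite ffunE gK.
- by apply/forallP => x; apply/forallP => y; rewrite !ffunE fI.
- by apply/forallP => x; apply/forallP => y; rewrite !ffunE fU.
Qed.

End Predicates.

(* Lattices with n elements are counted through the lattice structures on the *)
(* fixed carrier 'I_n, taken up to isomorphism; by lattice_on_complete below,   *)
(* every lattice with n elements is represented by such a structure.            *)
Section LatticesOnOrdinals.
Variable n : nat.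

Definition binop := {ffun 'I_n * 'I_n -> 'I_n}.

Definition lattice_axioms (o : binop * binop) : bool :=
  let m x y := o.1 (x, y) in let j x y := o.2 (x, y) in
  [&& [forall x, forall y, m x y == m y x],
      [forall x, forall y, j x y == j y x],
      [forall x, forall y, forall z, m x (m y z) == m (m x y) z],
      [forall x, forall y, forall z, j x (j y z) == j (j x y) z],
      [forall y, forall x, m x (j x y) == x]
    & [forall y, forall x, j x (m x y) == x]].

Definition lattice_on := {o : binop * binop | lattice_axioms o}.

(* An alias of 'I_n, so that the order of the structure L is not confused with *)
(* the usual total order of 'I_n.                                              *)
Definition carrier (L : lattice_on) : Type := 'I_n.

Section Instance.
Variable L : lattice_on.
Implicit Types x y z : carrier L.

HB.instance Definition _ := Finite.copy (carrier L) 'I_n.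

Definition carrier_meet x y : carrier L := (val L).1 (x, y).
Definition carrier_join x y : carrier L := (val L).2 (x, y).
Definition carrier_le : rel (carrier L) := fun x y => carrier_meet x y == x.

Let axiomsL : [/\ commutative carrier_meet, commutative carrier_join,
  associative carrier_meet & associative carrier_join] /\
  (forall y x, carrier_meet x (carrier_join x y) = x) /\
  (forall y x, carrier_join x (carrier_meet x y) = x).
Proof.
case/and5P: (valP L) => mC jC mA jA /andP[mjK jmK].
split; [split|split] => x y.
- exact/eqP/(forallP (forallP mC x)).
- exact/eqP/(forallP (forallP jC x)).
- by move=> z; apply/eqP/(forallP (forallP (forallP mA x) y)).
- by move=> z; apply/eqP/(forallP (forallP (forallP jA x) y)).
- exact/eqP/(forallP (forallP mjK x)).
- exact/eqP/(forallP (forallP jmK x)).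
Qed.

Fact carrier_meetC : commutative carrier_meet.
Proof. by have [[]] := axiomsL. Qed.

Fact carrier_joinC : commutative carrier_join.
Proof. by have [[]] := axiomsL. Qed.

Fact carrier_meetA : associative carrier_meet.
Proof. by have [[]] := axiomsL. Qed.

Fact carrier_joinA : associative carrier_join.
Proof. by have [[]] := axiomsL. Qed.

Fact carrier_joinKI y x : carrier_meet x (carrier_join x y) = x.
Proof. by have [_ []] := axiomsL. Qed.

Fact carrier_meetKU y x : carrier_join x (carrier_meet x y) = x.
Proof. by have [_ []] := axiomsL. Qed.

Fact carrier_le_refl : reflexive carrier_le.
Proof.
move=> x; apply/eqP.
by rewrite -[X in carrier_meet _ X](carrier_meetKU x) carrier_joinKI.
Qed.

Fact carrier_le_anti : antisymmetric carrier_le.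
Proof.
by move=> x y /andP[/eqP xy /eqP yx]; rewrite -[LHS]xy carrier_meetC yx.
Qed.

Fact carrier_le_trans : transitive carrier_le.
Proof.
move=> y x z /eqP xy /eqP yz; apply/eqP.
by rewrite -xy -carrier_meetA yz.
Qed.

HB.instance Definition _ :=
  Order.Le_isPOrder.Build (Order.Disp tt tt) (carrier L)
    carrier_le_refl carrier_le_anti carrier_le_trans.

Fact carrier_leEmeet x y : (x <= y) = (carrier_meet x y == x).
Proof. by []. Qed.

HB.instance Definition _ :=
  Order.POrder_isLattice.Build (Order.Disp tt tt) (carrier L)
    carrier_meetC carrier_joinC carrier_meetA carrier_joinA
    carrier_joinKI carrier_meetKU carrier_leEmeet.

End Instance.

Definition iso_on : rel lattice_on :=
  fun L M => isomorphic (carrier L) (carrier M).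

Lemma iso_on_equivalence : equivalence_rel iso_on.
Proof.
have refl L : iso_on L L.
  by apply/isomorphicP; exists id; split=> //; apply: (inv_bij (fun=> erefl)).
have sym L M : iso_on L M -> iso_on M L.
  case/isomorphicP => f [[g fK gK] fI fU]; apply/isomorphicP; exists g.
  split; first exact: (@Bijective _ _ g f).
    by move=> x y; apply: (can_inj fK); rewrite fI !gK.
  by move=> x y; apply: (can_inj fK); rewrite fU !gK.
have trans L M N : iso_on L M -> iso_on M N -> iso_on L N.
  case/isomorphicP => f [fB fI fU] /isomorphicP[g [gB gI gU]].
  apply/isomorphicP; exists (g \o f); split; first exact: bij_comp.
    by move=> x y /=; rewrite fI gI.
  by move=> x y /=; rewrite fU gU.
move=> L M N; split=> // LM; apply/idP/idP; last exact: trans.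
exact/trans/sym.
Qed.

Lemma lattice_on_complete d (T : finLatticeType d) :
  #|T| = n -> exists L : lattice_on, isomorphic T (carrier L).
Proof.
move=> cardT; pose f (x : T) := cast_ord cardT (enum_rank x).
pose g (i : 'I_n) : T := enum_val (cast_ord (esym cardT) i).
have fK : cancel f g by move=> x; rewrite /f /g cast_ordK enum_rankK.
have gK : cancel g f by move=> i; rewrite /f /g enum_valK cast_ordKV.
pose m : binop := [ffun p => f (g p.1 `&` g p.2)].
pose j : binop := [ffun p => f (g p.1 `|` g p.2)].
have ax : lattice_axioms (m, j).
  apply/and5P; split; last (apply/andP; split); apply/forallP => x;
    apply/forallP => y; try (apply/forallP => z); rewrite !ffunE /= ?fK.
  - by rewrite meetC.
  - by rewrite joinC.
  - by rewrite meetA.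
  - by rewrite joinA.
  - by rewrite joinKI gK.
  - by rewrite meetKU gK.
exists (Sub (m, j) ax); apply/isomorphicP; exists f; split.
- by exists g.
- move=> x y; rewrite [RHS](_ : _ = m (f x, f y)) ?SubK //.
  by rewrite ffunE /= !fK.
- move=> x y; rewrite [RHS](_ : _ = j (f x, f y)) ?SubK //.
  by rewrite ffunE /= !fK.
Qed.

End LatticesOnOrdinals.

Definition num_modular_lattices (n : nat) : nat :=
  #|equivalence_partition (@iso_on n) [set L | modular (carrier L)]|.

(* Main.v *)
(** A composition [c_1 + ... + c_(r-1)] of [n - 2] determines a graded poset
with levels [0], ..., [r] of sizes [1], [c_1], ..., [c_(r-1)], [1].  Single out
one "spine" element on each level, and put [u < v] when [v] is at least two
levels above [u], or exactly one level above with [u] or [v] on the spine.  Two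
incomparable elements [u], [v] lie on the same level or are non-spine elements
of adjacent levels; their join and meet are then the spine elements just above
the higher one and just below the lower one.  Hence the poset is a lattice with
[lev (u `|` v) + lev (u `&` v) = lev u + lev v], so it is modular.  The level
sizes are isomorphism invariants, so the [2 ^ (n - 3)] compositions yield
pairwise non-isomorphic lattices. *)
Require Import Defs.
From HB Require Import structures.
From mathcomp Require Import all_boot all_order all_algebra.
From mathcomp Require Import zify.

Set Implicit Arguments.
Unset Strict Implicit.
Unset Printing Implicit Defensive.

Import Order.LTheory.

(** * Transport along isomorphisms *)

Section Isomorphism.
Context {d d' : Order.disp_t}.
Variables (L : finLatticeType d) (M : finLatticeType d').

Lemma isomorphic_sym : isomorphic L M -> isomorphic M L.
Proof.
case/isomorphicP => f [[g fK gK] fI fU]; apply/isomorphicP; exists g.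
split=> [|x y|x y]; first exact: (@Bijective _ _ g f).
  by apply: (can_inj fK); rewrite fI !gK.
by apply: (can_inj fK); rewrite fU !gK.
Qed.

Lemma isomorphic_modular : isomorphic L M -> modular L -> modular M.
Proof.
case/isomorphicP => f [[g fK gK] fI fU] /modularP modL; apply/modularP=> a b c.
rewrite -(gK a) -(gK b) -(gK c) leEmeet -fI => /eqP/(can_inj fK) ca.
by rewrite -!(fI, fU) modL // leEmeet ca.
Qed.

End Isomorphism.

Lemma isomorphic_trans d1 d2 d3 (L : finLatticeType d1) (M : finLatticeType d2)
    (N : finLatticeType d3) :
  isomorphic L M -> isomorphic M N -> isomorphic L N.
Proof.
case/isomorphicP => f [fB fI fU] /isomorphicP[g [gB gI gU]].
apply/isomorphicP; exists (g \o f); split; first exact: bij_comp.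
  by move=> x y /=; rewrite fI gI.
by move=> x y /=; rewrite fU gU.
Qed.

(* The unused argument [f] selects the order put on this copy of ['I_n.+1]. *)
Definition spined n (f : {ffun 'I_(n - 2) -> bool}) : Type := 'I_n.+1.

(** * Levels and spine elements *)

Section Spine.
Variables (n : nat) (f : {ffun 'I_(n - 2) -> bool}).

(* Elements are listed level by level, the spine element of a level coming
   first; [f] tells which of the positions [2], ..., [n.-1] start a new level,
   while [0], [1] and [n] always do. *)
Definition on_spine (i : nat) : bool :=
  (i <= 1) || oapp f true (insub (i - 2)).

(** Counts the spine positions among [1], ..., [i]. As each level starts with its spine element,
    this is the index of the level containing [i]. *)
Fixpoint level (i : nat) : nat :=
  if i is j.+1 then level j + on_spine i else 0.

Lemma on_spine_free (j : 'I_(n - 2)) : on_spine j.+2 = f j.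
Proof. by rewrite /on_spine (_ : j.+2 - 2 = j) ?valK //=; lia. Qed.

(** For [n > 1], the index [n - 2] is out of range for ['I_(n - 2)], so the default [true] applies:
    the top element is alone on its level. *)
Lemma on_spine_last : on_spine n.
Proof.
rewrite /on_spine; case: leqP => //= n_gt1; rewrite insubF //.
by rewrite ltnn.
Qed.

Lemma levelS i : level i.+1 = level i + on_spine i.+1.
Proof. by []. Qed.

Lemma leq_level i j : i <= j -> level i <= level j.
Proof.
elim: j => [|j IH]; first by rewrite leqn0 => /eqP ->.
rewrite leq_eqVlt => /predU1P[-> //|/IH]; rewrite levelS; lia.
Qed.

Lemma ltn_level i j : i < j -> on_spine j -> level i < level j.
Proof.
case: j => // j; rewrite ltnS levelS => /leq_level le_ij ->; lia.
Qed.

Lemma level_gt0 i : 0 < i -> 0 < level i.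
Proof. by move=> i_gt0; apply: (@leq_level 1). Qed.

Lemma on_spine_inj i j :
  on_spine i -> on_spine j -> level i = level j -> i = j.
Proof.
move=> si sj eq_ij.
by case: (ltngtP i j) => // [/ltn_level/(_ sj)|/ltn_level/(_ si)];
  rewrite eq_ij ltnn.
Qed.

(** A discrete intermediate value argument: the level grows by at most one per position, and only at
    spine positions. *)
Lemma exists_spine k l : l <= level k ->
  exists2 i, i <= k & on_spine i && (level i == l).
Proof.
elim: k => [|k IH]; first by rewrite leqn0 => /eqP ->; exists 0.
case: (leqP l (level k)) => [/IH[i le_ik Hi] _|lt_l le_l].
  by exists i => //; apply: leqW.
exists k.+1 => //; move: le_l; rewrite levelS.
by case: (on_spine k.+1); lia.
Qed.

HB.instance Definition _ := Finite.copy (spined f) 'I_n.+1.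
Implicit Types u v w : spined f.

Lemma level_max u : level u <= level n.
Proof. by apply: leq_level; rewrite -ltnS; apply: ltn_ord. Qed.

Lemma level_min_spine u : level u = 0 -> on_spine u.
Proof.
by case: (posnP u) => [-> //|/level_gt0 lu l0]; rewrite l0 in lu.
Qed.

Lemma level_max_spine u : level u = level n -> on_spine u.
Proof.
move=> luN; case: (ltngtP u n) => [lt_un|lt_nu|->]; last exact: on_spine_last.
  by have:= ltn_level lt_un on_spine_last; rewrite luN ltnn.
by have:= ltn_ord u; rewrite ltnS leqNgt lt_nu.
Qed.

Lemma spine_unique u v : on_spine u -> on_spine v -> level u = level v -> u = v.
Proof. by move=> su sv luv; apply/val_inj/on_spine_inj. Qed.

(** The default [ord0] is reached only for [l > level n], by [exists_spine]. *)
Definition spine (l : nat) : spined f :=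
  odflt ord0 [pick u : spined f | on_spine u && (level u == l)].

Lemma spineP l : l <= level n -> on_spine (spine l) /\ level (spine l) = l.
Proof.
move=> /exists_spine[i le_in Hi]; rewrite /spine.
case: pickP => [u /andP[su /eqP lu] //|/(_ (Ordinal (le_in : i < n.+1)))] /=.
by rewrite Hi.
Qed.

(** * The partial order *)

Definition spined_le u v : bool :=
  [|| u == v, level u + 2 <= level v
    | (level v == (level u).+1) && (on_spine u || on_spine v)].

Fact spined_le_refl : reflexive spined_le.
Proof. by move=> u; rewrite /spined_le eqxx. Qed.

Fact spined_le_anti : antisymmetric spined_le.
Proof.
move=> u v; rewrite /spined_le (eq_sym v u).
by case: eqP => //= _; lia.
Qed.

(** Two strict steps raise the level by at least two, which alone gives comparability. *)
Fact spined_le_trans : transitive spined_le.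
Proof.
move=> v u w; rewrite {1 2}/spined_le.
case: eqP => [-> //|_] /= uv; case: eqP => [<-|_] /= vw.
  by rewrite /spined_le uv orbT.
by apply/or3P/Or32; lia.
Qed.

HB.instance Definition _ :=
  Order.Le_isPOrder.Build (Order.Disp tt tt) (spined f)
    spined_le_refl spined_le_anti spined_le_trans.

Lemma spined_leE u v : (u <= v)%O = spined_le u v.
Proof. by []. Qed.

Lemma level_lt u v : (u < v)%O -> level u < level v.
Proof.
by rewrite lt_neqAle spined_leE /spined_le => /andP[/negPf ->] /=; lia.
Qed.

Lemma level_le_eq u v : (u <= v)%O -> level u = level v -> u = v.
Proof.
rewrite le_eqVlt => /predU1P[-> //|/level_lt lt_uv e].
by rewrite e ltnn in lt_uv.
Qed.

Lemma spine_le l v : l <= level n ->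
  (spine l <= v)%O = (l < level v) || ((level v == l) && on_spine v).
Proof.
move=> /spineP[sl ll]; rewrite spined_leE /spined_le ll sl andbT.
case: (eqVneq (spine l) v) => [<-|ne] /=; first by rewrite ll eqxx sl orbT.
case: (ltngtP l (level v)) => [||e] /=; try lia.
case sv: (on_spine v); last by lia.
by rewrite (spine_unique sl sv) ?ll // eqxx in ne.
Qed.

Lemma le_spine l v : l <= level n ->
  (v <= spine l)%O = (level v < l) || ((level v == l) && on_spine v).
Proof.
move=> /spineP[sl ll]; rewrite spined_leE /spined_le ll sl orbT andbT.
case: (eqVneq v (spine l)) => [->|ne] /=; first by rewrite ll eqxx sl orbT.
case: (ltngtP (level v) l) => [||e] /=; try lia.
case sv: (on_spine v); last by lia.
by rewrite (spine_unique sv sl) ?ll // eqxx in ne.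
Qed.

(** * Joins and meets *)

Definition spined_join u v : spined f :=
  if (u <= v)%O then v else if (v <= u)%O then u
  else spine (maxn (level u) (level v)).+1.

Definition spined_meet u v : spined f :=
  if (u <= v)%O then u else if (v <= u)%O then v
  else spine (minn (level u) (level v)).-1.

(** The bottom and top levels are single spine elements, comparable to everything; so the levels
    just above and just below an incomparable pair exist. *)
Lemma incomparableP u v : (u <= v)%O = false -> (v <= u)%O = false ->
  [/\ 0 < level u < level n, 0 < level v < level n &
      [/\ u != v, level u = level v & ~~ (on_spine u && on_spine v)]
      \/ [/\ ~~ on_spine u, ~~ on_spine v &
             level u = (level v).+1 \/ level v = (level u).+1]].
Proof.
have [mu mv] := (level_max u, level_max v).
have [u0 v0] := (@level_min_spine u, @level_min_spine v).
have [u1 v1] := (@level_max_spine u, @level_max_spine v).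
have uv_uniq := @spine_unique u v.
rewrite !spined_leE /spined_le (eq_sym v u).
case: eqP => //= ne luv lvu.
have {}uv_uniq : ~~ [&& on_spine u, on_spine v & level u == level v].
  by apply/and3P => -[su sv /eqP luv']; apply/ne/uv_uniq.
(* Once levels and spine flags are abstracted, only linear arithmetic with booleans remains. *)
move: (level u) (level v) (level n) (on_spine u) (on_spine v)
  mu mv u0 v0 u1 v1 luv lvu uv_uniq => lu lv ln su sv.
move=> *; split; try lia.
case: (eqVneq lu lv) => [e|ne']; [left; split=> // | right; split]; lia.
Qed.

(** If [u] and [v] are incomparable, a common upper bound one level above the higher one must be on
    the spine: they are not both on the spine if their levels agree, and neither is otherwise. *)
Fact spined_joinP u v w :
  (spined_join u v <= w)%O = (u <= w)%O && (v <= w)%O.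
Proof.
rewrite /spined_join; case uv: (u <= v)%O.
  by apply/idP/andP => [vw|[]//]; split=> //; apply: le_trans uv vw.
case vu: (v <= u)%O.
  by apply/idP/andP => [uw|[]//]; split=> //; apply: le_trans vu uw.
have [lu lv H] := incomparableP uv vu.
rewrite spine_le; last by lia.
have uw := @spine_unique u w; have vw := @spine_unique v w.
case: (eqVneq u w) => [<-|nuw]; first by rewrite lexx vu; lia.
case: (eqVneq v w) => [<-|nvw]; first by rewrite lexx uv; lia.
rewrite !spined_leE /spined_le (negPf nuw) (negPf nvw) /=.
have {}uw : ~~ [&& on_spine u, on_spine w & level u == level w].
  by apply/and3P => -[su sw /eqP e]; move/eqP: nuw; apply; apply: uw.
have {}vw : ~~ [&& on_spine v, on_spine w & level v == level w].
  by apply/and3P => -[sv sw /eqP e]; move/eqP: nvw; apply; apply: vw.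
case: H => -[]; lia.
Qed.

Fact spined_meetP u v w :
  (u <= spined_meet v w)%O = (u <= v)%O && (u <= w)%O.
Proof.
rewrite /spined_meet; case vw: (v <= w)%O.
  by apply/idP/andP => [uv|[]//]; split=> //; apply: le_trans uv vw.
case wv: (w <= v)%O.
  by apply/idP/andP => [uw|[]//]; split=> //; apply: le_trans uw wv.
have [lv lw H] := incomparableP vw wv.
rewrite le_spine; last by lia.
have uv := @spine_unique u v; have uw := @spine_unique u w.
case: (eqVneq u v) => [->|nuv]; first by rewrite lexx vw; lia.
case: (eqVneq u w) => [->|nuw]; first by rewrite lexx wv; lia.
rewrite !spined_leE /spined_le (negPf nuv) (negPf nuw) /=.
have {}uv : ~~ [&& on_spine u, on_spine v & level u == level v].
  by apply/and3P => -[su sv /eqP e]; move/eqP: nuv; apply; apply: uv.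
have {}uw : ~~ [&& on_spine u, on_spine w & level u == level w].
  by apply/and3P => -[su sw /eqP e]; move/eqP: nuw; apply; apply: uw.
case: H => -[]; lia.
Qed.

HB.instance Definition _ :=
  Order.POrder_MeetJoin_isLattice.Build (Order.Disp tt tt) (spined f)
    spined_meetP spined_joinP.

(** * Modularity from the level function *)

Lemma level_meet_join u v :
  level (u `&` v)%O + level (u `|` v)%O = level u + level v.
Proof.
rewrite [(u `&` v)%O]/(spined_meet u v) [(u `|` v)%O]/(spined_join u v).
rewrite /spined_meet /spined_join.
case uv: (u <= v)%O => //; case vu: (v <= u)%O; first by rewrite addnC.
have [lu lv H] := incomparableP uv vu.
(* The [.+1] and [.-1] cancel because incomparable elements have positive level. *)
by rewrite !(proj2 (spineP _)); lia.
Qed.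

(** One inequality holds in every lattice, and comparable elements of equal level coincide, so
    comparing levels suffices. Both sides have the same level by four uses of [level_meet_join]. *)
Lemma spined_modular : modular (spined f).
Proof.
apply/modularP => a b c le_ca; apply/esym/level_le_eq.
  by rewrite lexI !leUx leIl le_ca /= leUr andbT (le_trans (leIr _ _)) ?leUl.
have:= level_meet_join a (b `|` c)%O; have := level_meet_join (a `&` b)%O c.
have:= level_meet_join a b; have:= level_meet_join b c.
have -> : (a `|` (b `|` c) = a `|` b)%O.
  by rewrite joinCA joinC (join_l le_ca) joinC.
have -> : (a `&` b `&` c = b `&` c)%O by rewrite -meetA meetCA (meet_r le_ca).
move: (level (b `&` c)%O) (level (b `|` c)%O) (level (a `&` b)%O)
  (level (a `|` b)%O) (level (a `&` b `|` c)%O) (level (a `&` (b `|` c))%O).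
by lia.
Qed.

(** * Levels as isomorphism invariants *)

Lemma level_pred v : 0 < level v ->
  exists2 u, (u < v)%O & level u = (level v).-1.
Proof.
move=> lv; have le_n : (level v).-1 <= level n by have := level_max v; lia.
exists (spine (level v).-1); last exact: (proj2 (spineP le_n)).
rewrite lt_neqAle spine_le //; apply/andP; split; last by lia.
by apply/eqP => e; have := proj2 (spineP le_n); rewrite e; lia.
Qed.

End Spine.

(** A chain descending from [x] one level at a time is mapped to a strict chain below [h x]. Applied
    to an isomorphism and its inverse, this shows that levels are preserved. *)
Lemma level_incr n (f g : {ffun 'I_(n - 2) -> bool})
    (h : spined f -> spined g) (x : spined f) :
  {homo h : x y / (x < y)%O} -> level f x <= level g (h x).
Proof.
move=> h_lt; move: {2}(level f x) (leqnn (level f x)) => l.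
elim: l x => [|l IH] x; first by rewrite leqn0 => /eqP ->.
case: (posnP (level f x)) => [-> //|/level_pred[y lt_yx ly] le_x].
have := IH y; have := level_lt (h_lt _ _ lt_yx); lia.
Qed.

(** The bit [f j] is the increment of the level from [j.+1] to [j.+2]. *)
Lemma level_inj n (f g : {ffun 'I_(n - 2) -> bool}) :
  (forall i, i <= n -> level f i = level g i) -> f = g.
Proof.
move=> efg; apply/ffunP => j; have lt_j := ltn_ord j.
have e1 : level f j.+1 = level g j.+1 by apply: efg; lia.
have : level f j.+2 = level g j.+2 by apply: efg; lia.
rewrite 2!(levelS _ j.+1) !on_spine_free e1 => /addnI.
by case: (f j); case: (g j).
Qed.

Lemma isomorphic_spined n (f g : {ffun 'I_(n - 2) -> bool}) :
  isomorphic (spined f) (spined g) -> f = g.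
Proof.
case/isomorphicP => h [[k hK kK] hI _].
have h_le x y : (h x <= h y)%O = (x <= y)%O.
  by rewrite !leEmeet -hI (inj_eq (can_inj hK)).
have h_lt : {homo h : x y / (x < y)%O}.
  by move=> x y; rewrite !lt_leAnge !h_le.
have k_lt : {homo k : x y / (x < y)%O}.
  by move=> x y; rewrite -{1}(kK x) -{1}(kK y) !lt_leAnge !h_le.
have lev_h x : level g (h x) = level f x.
  apply/eqP; rewrite eqn_leq level_incr // andbT.
  by rewrite -{2}(hK x) level_incr.
have srt (e : {ffun 'I_(n - 2) -> bool}) :
    sorted leq [seq level e i | i <- iota 0 n.+1].
  rewrite sorted_map; apply: sub_sorted (iota_sorted _ _).
  exact: leq_level.
have lev_ord (e : {ffun 'I_(n - 2) -> bool}) :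
    [seq level e i | i <- iota 0 n.+1] =
    [seq level e x | x : spined e <- enum {: spined e}].
  by rewrite -val_enum_ord -map_comp.
(* The isomorphism may permute positions, so it only matches the levels as multisets; since both
   lists are sorted, they are equal. *)
have eq_lev :
    [seq level f i | i <- iota 0 n.+1] = [seq level g i | i <- iota 0 n.+1].
  apply: (sorted_eq leq_trans anti_leq) => //; rewrite !lev_ord.
  rewrite -(eq_map lev_h) (map_comp (fun y : spined g => level g y) h).
  apply: perm_map; apply: uniq_perm => [||y].
  - by rewrite (map_inj_uniq (can_inj hK)); apply: enum_uniq.
  - exact: enum_uniq.
  - by rewrite mem_enum -(kK y) map_f ?mem_enum.
apply: level_inj => i le_in.
have lt_i : i < size (iota 0 n.+1) by rewrite size_iota.
have := congr1 (fun s => nth 0 s i) eq_lev.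
by rewrite !(nth_map 0) ?nth_iota.
Qed.

(** * Counting isomorphism classes *)

Lemma num_modular_lattices_lb n : 2 ^ (n - 2) <= num_modular_lattices n.+1.
Proof.
have cardS (f : {ffun 'I_(n - 2) -> bool}) : #|{: spined f}| = n.+1.
  exact: card_ord.
pose L (f : {ffun 'I_(n - 2) -> bool}) :=
  xchoose (lattice_on_complete (cardS f)).
have LP f : isomorphic (spined f) (carrier (L f)).
  exact: xchooseP (lattice_on_complete (cardS f)).
pose D := [set M : lattice_on n.+1 | modular (carrier M)].
have LD f : L f \in D.
  by rewrite inE; apply: isomorphic_modular (LP f) (spined_modular f).
(* [cl f] is the block of [L f] in the partition being counted; distinct [f] give distinct
   blocks. *)
pose cl f := [set M in D | iso_on (L f) M].
have cl_inj : injective cl.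
  move=> f g eq_fg; apply: isomorphic_spined.
  apply: isomorphic_trans (LP f) _.
  apply: isomorphic_trans (isomorphic_sym (LP g)).
  have : L g \in cl g.
    by rewrite inE LD; have [->] := iso_on_equivalence (L g) (L g) (L g).
  by rewrite -eq_fg inE => /andP[].
have -> : 2 ^ (n - 2) = #|[set cl f | f in {ffun 'I_(n - 2) -> bool}]|.
  by rewrite card_imset // card_ffun card_bool card_ord.
apply/subset_leq_card/subsetP => _ /imsetP[f _ ->].
apply: (imset_f (fun M => [set N in D | iso_on M N])).
exact: LD.
Qed.

Local Open Scope ring_scope.

Theorem theorem6p1 (n : nat) (n_gt0 : (0 < n)%N) :
  (2 : rat) ^ (n%:Z - 3) <= (num_modular_lattices n)%:R.
Proof.
case: n n_gt0 => // n _.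
(* Truncated subtraction can only enlarge the exponent: for [n < 2] the integer exponent is negative
   while [n - 2] is [0]. *)
apply: le_trans (_ : (2 ^ (n - 2))%N%:R <= _); last first.
  by rewrite Num.Theory.ler_nat num_modular_lattices_lb.
by rewrite GRing.natrX exprnP ler_weXz2l //; lia.
Qed.
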